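(* Let $\alpha\in(0,1)$, let $\Phi_1,\Phi_2$ be finite, continuous and strictly increasing normalized convex Young functions, and let $$\Phi(x)=1+\alpha\,\Phi_1\big((x-1)_+\big)-(1-\alpha)\,\Phi_2\big((x-1)_-\big),\qquad x\ge0.$$ Let $X\in L^\infty_+$ with $H_\Phi(X)>0$. Then: (a) $k=H_\Phi(X)$ is the unique positive solution of $$\alpha\,\mathbb E\Big[\Phi_1\Big(\tfrac{(X-k)_+}{k}\Big)\Big]=(1-\alpha)\,\mathbb E\Big[\Phi_2\Big(\tfrac{(k-X)_+}{k}\Big)\Big].$$ (b) Denote by $H_{\alpha,\Phi_1,\Phi_2}$ the Orlicz premium $H_\Phi$ associated with the parameters $(\alpha,\Phi_1,\Phi_2)$; let $\tilde\Phi_1,\tilde\Phi_2$ be functions of the same class as $\Phi_1,\Phi_2$. (i) If $\Phi_1\le\tilde\Phi_1$ pointwise, then $H_{\alpha,\Phi_1,\Phi_2}(X)\le H_{\alpha,\tilde\Phi_1,\Phi_2}(X)$. (ii) If $\Phi_2\le\tilde\Phi_2$ pointwise, then $H_{\alpha,\Phi_1,\Phi_2}(X)\ge H_{\alpha,\Phi_1,\tilde\Phi_2}(X)$. (iii) The map $\alpha\mapsto H_{\alpha,\Phi_1,\Phi_2}(X)$ is nondecreasing on $(0,1)$, and strictly increasing whenever $P(X\ne H_{\alpha,\Phi_1,\Phi_2}(X))>0$. (c) For $X,Y\in L^\infty_+$ write $X\preceq_{\Phi_1,\Phi_2}Y$ if for all $t>0$ $$\mathbb E\Big[\Phi_1\Big(\tfrac{(X-t)_+}{t}\Big)\Big]\le\mathbb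 E\Big[\Phi_1\Big(\tfrac{(Y-t)_+}{t}\Big)\Big]\quad\text{and}\quad\mathbb E\Big[\Phi_2\Big(\tfrac{(t-X)_+}{t}\Big)\Big]\ge\mathbb E\Big[\Phi_2\Big(\tfrac{(t-Y)_+}{t}\Big)\Big].$$ Then $X\preceq_{\Phi_1,\Phi_2}Y$ implies $H_{\alpha,\Phi_1,\Phi_2}(X)\le H_{\alpha,\Phi_1,\Phi_2}(Y)$ for every $\alpha\in(0,1)$.
   Context: Random variables are defined on a nonatomic probability space $(\Omega,\mathcal F,P)$; (in)equalities between them hold $P$-a.s. $L^\infty_+$ is the set of essentially bounded $X\ge0$; $(y)_+=\max(y,0)$, $(y)_-=\max(-y,0)$. A finite normalized convex Young function is a function $\Psi\colon[0,+\infty)\to[0,+\infty)$ that is nondecreasing, left-continuous, convex, with $\Psi(0)=0$, $\Psi(1)=1$ and $\lim_{x\to+\infty}\Psi(x)=+\infty$. For a nondecreasing, left-continuous $\Phi\colon[0,+\infty)\to[0,+\infty)$ with $\Phi\le1$ on $[0,1]$ and $\Phi>1$ on $(1,+\infty)$ (as is the case for $\Phi$ in the statement), the Orlicz premium is $H_\Phi(X)=\inf\{k>0:\mathbb E[\Phi(X/k)]\le1\}$, $X\in L^\infty_+$. *)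

(* Defs.v *)
From HB Require Import structures.
From mathcomp Require Import all_boot all_order all_algebra.
From mathcomp Require Import all_classical all_reals all_analysis.

Set Implicit Arguments.
Unset Strict Implicit.
Unset Printing Implicit Defensive.

Import Order.TTheory GRing.Theory Num.Theory.
Import numFieldNormedType.Exports.

Local Open Scope classical_set_scope.
Local Open Scope ring_scope.

Definition nonatomic (d : measure_display) (T : measurableType d)
    (R : realType) (P : probability T R) : Prop :=
  forall A : set T, measurable A -> (0 < P A)%E ->
    exists B : set T,
      [/\ measurable B, B `<=` A, (0 < P B)%E & (P B < P A)%E].

(* Elements are measurable representatives X : T -> R, not a.s. classes. *)
Definition Linfty_plus (d : measure_display) (T : measurableType d)
    (R : realType) (P : probability T R) (X : T -> R) : Prop :=
  X \in Lfun P +oo%E /\ {ae P, forall w, 0 <= X w}.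

(* A function on [0, +oo[ is represented by a total f : R -> R whose values at
   negative reals are irrelevant: they are neither constrained nor used. *)
Record normalized_Young (R : realType) (f : R -> R) : Prop := NormalizedYoung {
  Young_ge0 : forall x, 0 <= x -> 0 <= f x ;
  Young_nondecreasing : {in `[0, +oo[ &, {homo f : x y / x <= y}} ;
  Young_left_continuous : forall x, 0 < x -> f @ x^'- --> f x ;
  Young_convex : convex_function (`[0, +oo[%classic : set R^o) f ;
  Young0 : f 0 = 0 ;
  Young1 : f 1 = 1 ;
  Young_pinfty : f x @[x --> +oo] --> +oo }.

Definition continuous_strict_Young (R : realType) (f : R -> R) : Prop :=
  [/\ normalized_Young f,
      {within `[0, +oo[, continuous f} &
      {in `[0, +oo[ &, {homo f : x y / x < y}}].

(* The formula makes sense on all of R, since Phi1 and Phi2 are only evaluated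
   in [0, +oo[; as X / k >= 0 almost surely, the values at x < 0 play no role. *)
Definition asym_Phi (R : realType) (alpha : R) (Phi1 Phi2 : R -> R) (x : R) : R :=
  1 + alpha * Phi1 (Num.max (x - 1) 0)
    - (1 - alpha) * Phi2 (Num.max (- (x - 1)) 0).

(* The infimum is the real one: for X in L^oo_+ and Phi <= 1 on [0, 1] the set
   is nonempty (it contains every positive essential upper bound of X), and it
   is bounded below by 0. *)
Definition orlicz_premium (d : measure_display) (T : measurableType d)
    (R : realType) (P : probability T R) (Phi : R -> R) (X : T -> R) : R :=
  inf [set k : R | 0 < k /\ ('E_P[fun w => Phi (X w / k)%R] <= 1)%E].

Definition asym_premium (d : measure_display) (T : measurableType d) (R : realType)
    (P : probability T R) (alpha : R) (Phi1 Phi2 : R -> R) (X : T -> R) : R :=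
  orlicz_premium P (asym_Phi alpha Phi1 Phi2) X.

Definition excess (d : measure_display) (T : measurableType d) (R : realType)
    (P : probability T R) (Psi : R -> R) (X : T -> R) (k : R) : \bar R :=
  ('E_P[fun w => Psi (Num.max (X w - k) 0 / k)%R])%E.

Definition shortfall (d : measure_display) (T : measurableType d)
    (R : realType) (P : probability T R) (Psi : R -> R) (X : T -> R) (k : R) :
    \bar R :=
  ('E_P[fun w => Psi (Num.max (k - X w) 0 / k)%R])%E.

Definition Young_order (d : measure_display) (T : measurableType d)
    (R : realType) (P : probability T R) (Phi1 Phi2 : R -> R) (X Y : T -> R) :
    Prop :=
  forall t : R, 0 < t ->
    (excess P Phi1 X t <= excess P Phi1 Y t)%E /\
    (shortfall P Phi2 X t >= shortfall P Phi2 Y t)%E.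

(* Main.v *)
Require Import Defs.
From HB Require Import structures.
From mathcomp Require Import all_boot all_order all_algebra.
From mathcomp Require Import all_classical all_reals all_analysis.
From mathcomp Require Import ess_sup_inf measurable_realfun lra.

(** The function Phi is continuous and strictly increasing on the whole line,
    with Phi(0) = alpha < 1 = Phi(1). Hence k |-> E[Phi(X/k)] is continuous
    (dominated convergence) and nonincreasing on ]0, +oo[, strictly so unless
    X = 0 a.s., and a positive infimum H of {k > 0 : E[Phi(X/k)] <= 1} is the
    unique root of E[Phi(X/k)] = 1, which is the equation of (a). All
    monotonicity claims follow by comparing these expectations. If two
    parameters a < b give the same root h, both equations at h force excess and
    shortfall to vanish, so X = h a.s. and h is the root for every parameter. *)

Set Implicit Arguments.
Unset Strict Implicit.
Unset Printing Implicit Defensive.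

Import Order.TTheory GRing.Theory Num.Theory.
Import numFieldNormedType.Exports.

Local Open Scope classical_set_scope.
Local Open Scope ring_scope.

(** * Young functions composed with positive parts, and the resulting [asym_Phi] *)

Section young.
Context {R : realType}.
Implicit Types (Phi : R -> R) (alpha x y : R).

(** Since [Num.max x 0] never leaves the half-line, continuity of [Phi] within it becomes continuity
    on all of R. *)
Lemma Young_continuous_max0 Phi : continuous_strict_Young Phi ->
  continuous (fun x => Phi (Num.max x 0)).
Proof.
case=> _ /subspace_continuousP Phic _ x.
have x0 : `[0, +oo[%classic (Num.max x 0).
  by rewrite /= in_itv/= le_max lexx orbT.
apply: (cvg_trans _ (Phic _ x0)).
have : (fun y : R => Num.max y 0) @ x --> Num.max x 0.
  have := @continuous_max R R id (cst 0) x; apply.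
    exact: cvg_id.
  exact: cvg_cst.
move=> mc A /= wA.
have : nbhs x [set y | `[0, +oo[%classic (Num.max y 0) ->
                       A (Phi (Num.max y 0))].
  exact: (mc _ wA).
apply: filterS => y /= wAy; apply: wAy.
by rewrite in_itv/= le_max lexx orbT.
Qed.

Lemma Young_lt_max0 Phi x y : continuous_strict_Young Phi ->
  x < y -> 0 < y -> Phi (Num.max x 0) < Phi (Num.max y 0).
Proof.
case=> _ _ Phi_lt xy y0; apply: Phi_lt.
- by rewrite in_itv/= le_max lexx orbT.
- by rewrite in_itv/= le_max lexx orbT.
- by rewrite gt_max !lt_max xy y0.
Qed.

Lemma Young_le_max0 Phi : continuous_strict_Young Phi ->
  {homo (fun x => Phi (Num.max x 0)) : x y / x <= y}.
Proof.
case=> HPhi _ _ x y xy; apply: Young_nondecreasing HPhi _ _ _ _ _.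
- by rewrite in_itv/= le_max lexx orbT.
- by rewrite in_itv/= le_max lexx orbT.
- by rewrite ge_max !le_max xy lexx orbT.
Qed.

Lemma Young_max0_ge0 Phi x : continuous_strict_Young Phi ->
  0 <= Phi (Num.max x 0).
Proof. by case=> HPhi _ _; rewrite (Young_ge0 HPhi)// le_max lexx orbT. Qed.

Lemma Young_max0_eq0 Phi x : continuous_strict_Young Phi ->
  Phi (Num.max x 0) = 0 -> x <= 0.
Proof.
move=> HPhi Phix0; rewrite leNgt; apply/negP => x0.
have := Young_lt_max0 HPhi x0 x0; case: HPhi => HPhi _ _.
by rewrite Phix0 maxxx (Young0 HPhi) ltxx.
Qed.

(** For x > 1, write 1 as the convex combination of x and 0 with weight 1/x on x; convexity gives 1
    <= Phi(x)/x. This linear growth later keeps the premium away from 0. *)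
Lemma Young_max0_ge_sub1 Phi x : continuous_strict_Young Phi ->
  x - 1 <= Phi (Num.max x 0).
Proof.
move=> HPhi; have [x1|x1] := lerP x 1.
  by rewrite (le_trans _ (Young_max0_ge0 x HPhi))// subr_le0.
have x0 : 0 < x by rewrite (lt_trans _ x1).
rewrite max_l ?ltW//; case: HPhi => HPhi _ _.
have xV0 : 0 <= x^-1 by rewrite invr_ge0 ltW.
have xV1 : x^-1 <= 1 by rewrite invf_le1// ltW.
have : Phi (x^-1 * x + (1 - x^-1) * 0) <= x^-1 * Phi x + (1 - x^-1) * Phi 0.
  have := @Young_convex _ _ HPhi (Itv01 xV0 xV1) x 0.
  by rewrite !inE/= !in_itv/= !lexx (ltW x0)/=; exact.
rewrite (Young0 HPhi) !mulr0 !addr0 mulVf ?gt_eqF// (Young1 HPhi).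
by rewrite mulrC ler_pdivlMr// mul1r; apply: lt_le_trans; rewrite gtrBl.
Qed.

(** At x = X/k with k > 0, [up_part] and [down_part] are the integrands of [excess] and [shortfall],
    because (X - k)_+ / k = (X/k - 1)_+. *)
Definition up_part (Phi : R -> R) (x : R) : R := Phi (Num.max (x - 1) 0).
Definition down_part (Phi : R -> R) (x : R) : R := Phi (Num.max (- (x - 1)) 0).

Lemma up_part_continuous Phi : continuous_strict_Young Phi ->
  continuous (up_part Phi).
Proof.
move=> HPhi x.
have subc : y - 1 @[y --> x] --> x - 1 by apply: cvgB => //; exact: cvg_cst.
apply: (@cvg_comp _ _ _ _ (fun z => Phi (Num.max z 0)) _ _ _ subc).
exact: (Young_continuous_max0 HPhi).
Qed.

Lemma down_part_continuous Phi : continuous_strict_Young Phi ->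
  continuous (down_part Phi).
Proof.
move=> HPhi x.
have subc : y - 1 @[y --> x] --> x - 1 by apply: cvgB => //; exact: cvg_cst.
apply: (@cvg_comp _ _ _ _ (fun z => Phi (Num.max z 0)) _ _ _ (cvgN subc)).
exact: (Young_continuous_max0 HPhi).
Qed.

Lemma asym_Phi_continuous alpha Phi1 Phi2 : continuous_strict_Young Phi1 ->
  continuous_strict_Young Phi2 -> continuous (asym_Phi alpha Phi1 Phi2).
Proof.
move=> HPhi1 HPhi2 x; apply: cvgB.
  apply: cvgD; first exact: cvg_cst.
  by apply: cvgM; [exact: cvg_cst|exact: up_part_continuous].
by apply: cvgM; [exact: cvg_cst|exact: down_part_continuous].
Qed.

(** If y > 1, the strict increase comes from the [Phi1] term; if y <= 1, then x < 1 and it comes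
    from the [Phi2] term. The other term is monotone in the right direction. *)
Lemma asym_Phi_lt alpha Phi1 Phi2 : 0 < alpha < 1 ->
  continuous_strict_Young Phi1 -> continuous_strict_Young Phi2 ->
  {homo asym_Phi alpha Phi1 Phi2 : x y / x < y}.
Proof.
move=> /andP[a0 a1] HPhi1 HPhi2 x y xy; rewrite /asym_Phi.
have b0 : 0 < 1 - alpha by rewrite subr_gt0.
have xy1 : x - 1 < y - 1 by rewrite ltrD2r.
have yx1 : - (y - 1) < - (x - 1) by rewrite ltrN2.
have [y1|y1] := ltP 1 y.
  apply: ltr_leB; last first.
    by rewrite ler_pM2l//; apply: (Young_le_max0 HPhi2); rewrite ltW.
  by rewrite ltrD2l ltr_pM2l// Young_lt_max0// subr_gt0.
apply: ler_ltB.
  by rewrite lerD2l ler_pM2l//; apply: (Young_le_max0 HPhi1); rewrite ltW.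
by rewrite ltr_pM2l// Young_lt_max0// oppr_gt0 subr_lt0 (lt_le_trans xy).
Qed.

Lemma asym_Phi0_lt1 alpha Phi1 Phi2 : 0 < alpha < 1 ->
  continuous_strict_Young Phi1 -> continuous_strict_Young Phi2 ->
  asym_Phi alpha Phi1 Phi2 0 < 1.
Proof.
move=> /andP[a0 a1] [HPhi1 _ _] [HPhi2 _ _].
rewrite /asym_Phi sub0r opprK max_r// max_l// (Young0 HPhi1) (Young1 HPhi2).
by rewrite mulr0 addr0 mulr1 gtrBl subr_gt0.
Qed.

Lemma asym_Phi1 alpha Phi1 Phi2 :
  continuous_strict_Young Phi1 -> continuous_strict_Young Phi2 ->
  asym_Phi alpha Phi1 Phi2 1 = 1.
Proof.
move=> [HPhi1 _ _] [HPhi2 _ _].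
rewrite /asym_Phi subrr oppr0 maxxx (Young0 HPhi1) (Young0 HPhi2).
by rewrite !mulr0 addr0 subr0.
Qed.

(** The [Phi1] term grows at least linearly, and for x >= 0 the argument of [Phi2] is at most 1, so
    the subtracted term is at most 1 - alpha. *)
Lemma asym_Phi_ge_affine alpha Phi1 Phi2 x : 0 < alpha < 1 ->
  continuous_strict_Young Phi1 -> continuous_strict_Young Phi2 ->
  0 <= x -> alpha * (x - 2) <= asym_Phi alpha Phi1 Phi2 x.
Proof.
move=> /andP[a0 a1] HPhi1 HPhi2 x0; rewrite /asym_Phi.
have : alpha * (x - 1 - 1) <= alpha * Phi1 (Num.max (x - 1) 0).
  by rewrite ler_pM2l// Young_max0_ge_sub1.
have : (1 - alpha) * Phi2 (Num.max (- (x - 1)) 0) <= 1 - alpha.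
  rewrite -[leRHS]mulr1 ler_pM2l ?subr_gt0//.
  have : - (x - 1) <= 1 by rewrite opprB gerBl.
  move/(Young_le_max0 HPhi2); case: HPhi2 => HPhi2 _ _.
  by rewrite (max_l (ler01 : 0 <= 1 :> R)) (Young1 HPhi2).
lra.
Qed.

End young.

(** * The map k |-> E[G(X/k)] for bounded X >= 0: continuity and strictness *)

Section bounded_mean.
Context {d : measure_display} {T : measurableType d} {R : realType}.
Variable P : probability T R.
Implicit Types (f X : T -> R) (G : R -> R) (a b k M : R).

Lemma bounded_integrable f a b : measurable_fun setT f ->
  (forall w, a <= f w <= b) -> P.-integrable setT (EFin \o f).
Proof.
move=> mf fab; apply: measurable_bounded_integrable => //.
  by rewrite (le_lt_trans (probability_le1 _ _))// ltry.
exists (Num.max `|a| `|b|); split; first by rewrite num_real.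
move=> y aby w _; apply: le_trans (ltW aby).
rewrite ler_norml; have /andP[aw wb] := fab w; apply/andP; split.
  rewrite (le_trans _ aw)// lerNl (le_trans (ler_norm _))// normrN.
  by rewrite le_max lexx.
by rewrite (le_trans wb)// (le_trans (ler_norm _))// le_max lexx orbT.
Qed.

Lemma Rintegral_eq0_ae f : P.-integrable setT (EFin \o f) ->
  (forall w, 0 <= f w) -> \int[P]_w f w = 0 -> {ae P, forall w, f w = 0}.
Proof.
move=> intf f0 /eqP.
(* Integrability excludes the case where the real integral is 0 only because [fine] sends an
   infinite value to 0. *)
rewrite -eqe /Rintegral fineK; last exact: integrable_fin_num.
move=> /eqP intf0.
have mf := measurable_int P intf.
have /(ae_eq_integral_abs P measurableT mf) :
    (\int[P]_w `|(EFin \o f) w| = 0)%E.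
  by rewrite -[RHS]intf0; apply: eq_integral => w _; rewrite /= ger0_norm.
by apply: filterS => w /(_ I) [].
Qed.

Definition mean G X k := \int[P]_w G (X w / k).

Section bounded_variable.
Variables (G : R -> R) (X : T -> R) (M : R).
Hypotheses (G_cont : continuous G) (G_lt : {homo G : x y / x < y}).
Hypotheses (mX : measurable_fun setT X) (X0M : forall w, 0 <= X w <= M).

Let G_le : {homo G : x y / x <= y}.
Proof. by move=> x y; rewrite le_eqVlt => /predU1P[->//|/G_lt/ltW]. Qed.

Lemma mean_comp_measurable k : measurable_fun setT (fun w => G (X w / k)).
Proof.
apply: (measurableT_comp (continuous_measurable_fun G_cont)).
exact: measurable_funM.
Qed.

Lemma mean_comp_bounded k w : 0 < k -> G 0 <= G (X w / k) <= G (M / k).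
Proof.
have /andP[X0 XM] := X0M w.
by move=> k0; rewrite !G_le// ?divr_ge0 ?ler_pM2r ?invr_gt0// ltW.
Qed.

Lemma mean_integrable k : 0 < k ->
  P.-integrable setT (EFin \o (fun w => G (X w / k))).
Proof.
move=> k0; apply: bounded_integrable (mean_comp_measurable k) _ => w.
exact: mean_comp_bounded.
Qed.

Lemma expectation_mean k : 0 < k ->
  ('E_P[fun w => G (X w / k)%R] = (mean G X k)%:E)%E.
Proof.
move=> k0; rewrite unlock /mean /Rintegral fineK//.
apply: integrable_fin_num => //; exact: mean_integrable.
Qed.

(** Dominated convergence on the neighbourhood ]k/2, 2k[, which stays away from the singularity at
    0. *)
Lemma mean_continuous k : 0 < k -> mean G X l @[l --> k] --> mean G X k.
Proof.
move=> k0.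
have k2 : 0 < k / 2 by rewrite divr_gt0.
have kI : k \in (`]k / 2, (k *+ 2)[%classic : set R).
  by rewrite inE/= in_itv/= gtr_pMr// invf_lt1// ltr1n mulr2n ltrDl k0.
have I0 l : `]k / 2, (k *+ 2)[%classic l -> k / 2 < l.
  by rewrite /= in_itv/= => /andP[].
(* For l > k/2 the integrand lies between G(0) and G(M/(k/2)), so this constant dominates it. *)
pose c := `|G 0| + `|G (M / (k / 2))|.
have gint : P.-integrable setT (EFin \o (cst c : T -> R)).
  by apply: (@bounded_integrable _ c c) => // w; rewrite lexx.
apply: (continuity_under_integral measurableT _ _ gint _ kI).
- move=> l /I0 kl; apply: mean_integrable; exact: lt_trans kl.
- apply: aeW => w _ l /set_mem/I0 kl.
  have l0 : 0 < l by exact: lt_trans kl.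
  apply: continuous_comp; last exact: G_cont.
  apply: cvgM; first exact: cvg_cst.
  by apply: cvgV => //; rewrite gt_eqF.
- move=> l /I0 kl; have l0 : 0 < l by exact: lt_trans kl.
  apply: aeW => w _ /=.
  have /andP[GX XG] := mean_comp_bounded w l0.
  have /andP[X0 XM] := X0M w.
  have {}XG : G (X w / l) <= G (M / (k / 2)).
    rewrite (le_trans XG)// G_le// ler_wpM2l ?(le_trans X0)// lef_pV2//.
    exact: ltW.
  have /= := ler_norm (G (M / (k / 2))); have := lerNnormlW (lexx `|G 0|).
  have := normr_ge0 (G 0); have := normr_ge0 (G (M / (k / 2))).
  rewrite ler_norml /c; lra.
Qed.

(** As X >= 0, a zero integral encodes X = 0 a.s., and then X/k = 0 a.s. *)
Lemma mean_ae0 k : \int[P]_w X w = 0 -> mean G X k = G 0.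
Proof.
move=> /(Rintegral_eq0_ae (bounded_integrable mX X0M))-[w|N [mN PN X0N]].
  by have /andP[] := X0M w.
rewrite /mean /Rintegral (ae_eq_integral (cst (G 0)%:E)) //.
- by rewrite integral_cst//= (probability_setT P) mule1.
- by apply/measurable_EFinP; exact: mean_comp_measurable.
- exists N; split => // w /= GX; apply: X0N => /= Xw0; apply: GX => _.
  by rewrite Xw0 mul0r.
Qed.

(** The nonnegative difference G(X/j) - G(X/k) has zero integral, so it vanishes a.s.; strict
    monotonicity of G allows this only where X = 0. Uniqueness of the root rests on this. *)
Lemma mean_eq_Rintegral0 j k : 0 < j -> j < k -> mean G X j = mean G X k ->
  \int[P]_w X w = 0.
Proof.
move=> j0 jk jkE; have k0 : 0 < k by exact: lt_trans jk.
have le_jk w : G (X w / k) <= G (X w / j).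
  by have /andP[X0 _] := X0M w; apply: G_le; rewrite ler_wpM2l// lef_pV2// ltW.
have int_jk : \int[P]_w (G (X w / j) - G (X w / k)) = 0.
  by rewrite RintegralB//; [move/eqP: jkE; rewrite -subr_eq0 => /eqP|
    exact: mean_integrable|exact: mean_integrable].
have intB : P.-integrable setT
    (EFin \o (fun w => G (X w / j) - G (X w / k))).
  apply: (@bounded_integrable _ 0 (G (M / j) - G 0)) => [|w].
    by apply: measurable_funB; exact: mean_comp_measurable.
  have /andP[_ GjM] := mean_comp_bounded w j0.
  by have /andP[Gk0 _] := mean_comp_bounded w k0; rewrite subr_ge0 le_jk lerB.
have [|N [mN PN XN]] := Rintegral_eq0_ae intB _ int_jk.
  by move=> w; rewrite subr_ge0.
rewrite /Rintegral (ae_eq_integral (cst 0%E)) ?integral_cst ?mul0e//.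
  exact/measurable_EFinP.
exists N; split => // w Xw; apply: XN => /= /eqP; rewrite subr_eq0 => /eqP Gjk.
apply: Xw => _; congr (_%:E); have /andP[X0 _] := X0M w.
apply/eqP; rewrite eq_le X0 andbT leNgt; apply/negP => Xw0.
suff : G (X w / k) < G (X w / j) by rewrite Gjk ltxx.
by apply: G_lt; rewrite ltr_pM2l// ltf_pV2.
Qed.

End bounded_variable.
End bounded_mean.

(** * The Orlicz premium as a root of E[G(X/k)] = 1 *)

Section premium.
Context {d : measure_display} {T : measurableType d} {R : realType}.
Variable P : probability T R.
Implicit Types (X Y : T -> R) (G : R -> R) (c j k M : R).

Record premium_function (G : R -> R) : Prop := PremiumFunction {
  premium_function_continuous : continuous G ;
  premium_function_lt : {homo G : x y / x < y} ;
  premium_function0 : G 0 < 1 ;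
  premium_function1 : G 1 = 1 }.

(** The bounds hold everywhere rather than a.s.; [Linfty_plus_bounded] provides such a
    representative. *)
Record bounded_nonneg (X : T -> R) (M : R) : Prop := BoundedNonneg {
  bounded_nonneg_measurable : measurable_fun setT X ;
  bounded_nonnegP : forall w, 0 <= X w <= M }.

Lemma orlicz_premium_mean G X M : premium_function G -> bounded_nonneg X M ->
  orlicz_premium P G X = inf [set k | 0 < k /\ mean P G X k <= 1].
Proof.
move=> [Gc Glt _ _] [mX XM]; congr inf; apply/seteqP; split => k [k0 /=].
  by rewrite (expectation_mean P Gc Glt mX XM)// lee_fin.
by move=> Gk; split=> //; rewrite (expectation_mean P Gc Glt mX XM)// lee_fin.
Qed.

Lemma mean_le1_ex G X M : premium_function G -> bounded_nonneg X M ->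
  [set k | 0 < k /\ mean P G X k <= 1] !=set0.
Proof.
move=> [Gc Glt _ G1] [mX XM].
(* An upper bound k of X gives X/k <= 1, hence G(X/k) <= G(1) = 1; the maximum with 1 makes k
   positive even when M = 0. *)
have M1 : 0 < Num.max M 1 by rewrite lt_max ltr01 orbT.
exists (Num.max M 1); split => //.
have int1 : \int[P]_w (1 : R) = 1.
  by rewrite Rintegral_cst//= (probability_setT P) mulr1.
rewrite -[leRHS]int1.
apply: le_Rintegral => //; first exact: (mean_integrable P Gc Glt mX XM M1).
  by apply: (@bounded_integrable _ _ _ P _ 1 1) => // w; rewrite lexx.
move=> w _; have /andP[_ XwM] := XM w.
have : X w / Num.max M 1 <= 1.
  by rewrite ler_pdivrMr// mul1r le_max XwM.
rewrite le_eqVlt => /predU1P[->|XM1]; first by rewrite G1.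
by rewrite -[leRHS]G1 ltW// Glt.
Qed.

Lemma mean_le1_lbound G X : lbound [set k | 0 < k /\ mean P G X k <= 1] 0.
Proof. by move=> k [k0 _]; exact: ltW. Qed.

Lemma orlicz_premium_le G X M k : premium_function G -> bounded_nonneg X M ->
  0 < k -> mean P G X k <= 1 -> orlicz_premium P G X <= k.
Proof.
move=> HG HX k0 Gk; rewrite (orlicz_premium_mean HG HX).
by apply: ge_inf => //; exists 0; exact: mean_le1_lbound.
Qed.

Lemma le_orlicz_premium G X M H Y N :
  premium_function G -> bounded_nonneg X M ->
  premium_function H -> bounded_nonneg Y N ->
  (forall k, 0 < k -> mean P G X k <= mean P H Y k) ->
  orlicz_premium P G X <= orlicz_premium P H Y.
Proof.
move=> HG HX HH HY GXHY; rewrite (orlicz_premium_mean HH HY).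
apply: lb_le_inf (mean_le1_ex HH HY) _ => k [k0 Hk].
by apply: (orlicz_premium_le HG HX) => //; rewrite (le_trans (GXHY _ _)).
Qed.

(** By continuity, a mean above 1 at the infimum h would stay above 1 near h, although admissible k
    come arbitrarily close; a mean below 1 would make some k < h admissible. *)
Lemma mean_orlicz_premium G X M : premium_function G -> bounded_nonneg X M ->
  0 < orlicz_premium P G X -> mean P G X (orlicz_premium P G X) = 1.
Proof.
move=> HG HX h0; have [Gc Glt _ _] := HG; have [mX XM] := HX.
set h := orlicz_premium P G X.
have Gh := mean_continuous (P := P) Gc Glt mX XM h0.
apply/eqP; rewrite eq_le; apply/andP; split; rewrite leNgt; apply/negP => Gh1.
  have /nbhs_ballP[e /= e0 he] : nbhs h [set x | 1 < mean P G X x].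
    exact: (cvgr_gt _ Gh).
  have : h < h + e by rewrite ltrDl.
  rewrite {1}/h (orlicz_premium_mean HG HX) => /(inf_lt (mean_le1_ex HG HX)).
  move=> [k [k0 Gk] khe].
  have hk : h <= k by exact: (orlicz_premium_le HG HX).
  have /he : ball h e k.
    by rewrite /ball/= ler0_norm ?subr_le0// opprB ltrBlDl.
  by rewrite /= ltNge Gk.
have /nbhs_ballP[e /= e0 he] : nbhs h [set x | mean P G X x < 1].
  exact: (cvgr_lt _ Gh).
(* The first term keeps k positive, the second keeps it in the ball; both are below h. *)
pose k := Num.max (h / 2) (h - e / 2).
have k0 : 0 < k by rewrite lt_max divr_gt0.
have kh : k < h by rewrite gt_max gtr_pMr// invf_lt1// ltr1n gtrBl divr_gt0.
have /he/ltW Gk : ball h e k.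
  rewrite /ball/= gtr0_norm ?subr_gt0// ltrBlDr -ltrBlDl lt_max.
  by rewrite ltrD2l ltrN2 gtr_pMr// invf_lt1// ltr1n orbT.
by have := orlicz_premium_le HG HX k0 Gk; rewrite leNgt kh.
Qed.

(** A root k is admissible, so h <= k. If h < k, equal means at h and k force X = 0 a.s., and the
    mean would be G(0) < 1. *)
Lemma orlicz_premium_unique G X M k : premium_function G ->
  bounded_nonneg X M -> 0 < orlicz_premium P G X -> 0 < k ->
  mean P G X k = 1 -> orlicz_premium P G X = k.
Proof.
move=> HG HX h0 k0 Gk; have [Gc Glt G0 _] := HG; have [mX XM] := HX.
apply/eqP; rewrite eq_le (orlicz_premium_le HG HX)// ?Gk// leNgt.
apply/negP => hk; have Gh := mean_orlicz_premium HG HX h0.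
have X0 : \int[P]_w X w = 0.
  by apply: (mean_eq_Rintegral0 Gc Glt mX XM h0 hk); rewrite Gh Gk.
by move: G0; rewrite -(mean_ae0 Gc mX XM k X0) Gk ltxx.
Qed.

(** If X = 0 a.s., the mean at the premium would be G(0) < 1 instead of 1. Together with
    [orlicz_premium_gt0] this carries positivity of the premium from one alpha to all others. *)
Lemma orlicz_premium_gt0_Rintegral G X M : premium_function G ->
  bounded_nonneg X M -> 0 < orlicz_premium P G X -> 0 < \int[P]_w X w.
Proof.
move=> HG HX h0; have [Gc Glt G0 _] := HG; have [mX XM] := HX.
rewrite lt_def Rintegral_ge0 ?andbT => [|w _]; last by have /andP[] := XM w.
apply/eqP => X0; have := mean_orlicz_premium HG HX h0.
by rewrite (mean_ae0 Gc mX XM _ X0); apply/eqP; rewrite lt_eqF.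
Qed.

Lemma orlicz_premium_gt0 G X M c : premium_function G ->
  bounded_nonneg X M -> 0 < c -> (forall x, 0 <= x -> c * (x - 2) <= G x) ->
  0 < \int[P]_w X w -> 0 < orlicz_premium P G X.
Proof.
move=> HG HX c0 cG X0; have [Gc Glt G0 _] := HG; have [mX XM] := HX.
have intX := bounded_integrable P mX XM.
have int1 a : P.-integrable setT (EFin \o (cst a : T -> R)).
  by apply: (@bounded_integrable _ _ _ P _ a a) => // w; rewrite lexx.
(* The affine minorant gives E[G(X/k)] >= c * (E[X]/k - 2), so E[G(X/k)] <= 1
   forces k >= c * E[X] / (1 + 2c). *)
apply: (@lt_le_trans _ _ (c * (\int[P]_w X w) / (1 + c * 2))).
  by rewrite !(divr_gt0, mulr_gt0, addr_gt0).
rewrite (orlicz_premium_mean HG HX).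
apply: lb_le_inf (mean_le1_ex HG HX) _ => k [k0 Gk].
have : \int[P]_w (c / k * X w - c * 2) <= mean P G X k.
  apply: le_Rintegral => //; last 1 first.
  - move=> w _; have /andP[X0w _] := XM w.
    rewrite (le_trans _ (cG _ (divr_ge0 X0w (ltW k0))))//.
    by rewrite mulrBr lerD2r mulrA mulrAC.
  - apply: (@bounded_integrable _ _ _ P _ (- (c * 2)) (c / k * M - c * 2)).
      by apply: measurable_funB => //; exact: measurable_funM.
    move=> w; have /andP[X0w XwM] := XM w.
    by rewrite lerD2r ler_pM2l ?divr_gt0// XwM lerDr mulr_ge0// ltW// divr_gt0.
  - exact: (mean_integrable P Gc Glt mX XM).
rewrite RintegralB//; last by exact: (int1 (c * 2)).
  rewrite RintegralZl// Rintegral_cst//= (probability_setT P) mulr1.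
  move=> /le_trans/(_ Gk); rewrite lerBlDr mulrAC ler_pdivrMr// => cXk.
  by rewrite ler_pdivrMr ?addr_gt0 ?mulr_gt0// [leRHS]mulrC.
apply: (@bounded_integrable _ _ _ P _ 0 (c / k * M)).
  exact: measurable_funM.
move=> w; have /andP[X0w XwM] := XM w.
by rewrite ler_pM2l ?divr_gt0// XwM mulr_ge0// ltW// divr_gt0.
Qed.

End premium.

(** * Bounded representatives, and the mean of [asym_Phi] in terms of excess and shortfall *)

Section asym_premium.
Context {d : measure_display} {T : measurableType d} {R : realType}.
Variable P : probability T R.
Implicit Types (X Y : T -> R) (f Phi : R -> R) (alpha k M : R).

Lemma Linfty_plus_bounded X : Linfty_plus P X ->
  exists Y M, [/\ bounded_nonneg Y M, measurable_fun setT X &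
    {ae P, forall w, X w = Y w}].
Proof.
case=> /andP[]; rewrite !inE/= => mX; rewrite /finite_norm unlock/=.
(* The norm at exponent +oo is defined by cases on whether the total mass is positive. *)
rewrite (probability_setT P) lte01 => supX aeX0.
have [M aeXM] := ess_supr_bounded supX.
(* X is truncated to the interval from 0 to [Num.max 0 M], which is nonempty whatever the sign of
   the essential bound M. *)
exists (fun w => Num.max 0 (Num.min (X w) (Num.max 0 M))), (Num.max 0 M).
split => //.
  split; first by apply: measurable_maxr => //; exact: measurable_minr.
  move=> w; rewrite le_max lexx/= ge_max ge_min lexx orbT andbT.
  by rewrite le_max lexx.
apply: filterS2 aeX0 aeXM => w X0 XM.
have XM' : X w <= M by rewrite (le_trans (ler_norm _)).
by rewrite min_l ?le_max ?XM' ?orbT// max_r.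
Qed.

Lemma eq_ae_expectation f X Y : measurable_fun setT f ->
  measurable_fun setT X -> measurable_fun setT Y ->
  {ae P, forall w, X w = Y w} ->
  ('E_P[fun w => f (X w)] = 'E_P[fun w => f (Y w)])%E.
Proof.
move=> mf mX mY XY; rewrite unlock; apply: ae_eq_integral => //.
- by apply/measurable_EFinP; exact: (measurableT_comp mf).
- by apply/measurable_EFinP; exact: (measurableT_comp mf).
- by apply: filterS XY => w -> _.
Qed.

Lemma up_part_bounded Phi Y M k w : continuous_strict_Young Phi ->
  bounded_nonneg Y M -> 0 < k ->
  0 <= up_part Phi (Y w / k) <= up_part Phi (M / k).
Proof.
move=> HPhi [_ YM] k0; have /andP[_ YwM] := YM w.
rewrite Young_max0_ge0//=; apply: (Young_le_max0 HPhi).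
by rewrite lerD2r ler_pM2r ?invr_gt0.
Qed.

Lemma down_part_bounded Phi Y M k w : continuous_strict_Young Phi ->
  bounded_nonneg Y M -> 0 < k ->
  0 <= down_part Phi (Y w / k) <= down_part Phi 0.
Proof.
move=> HPhi [_ YM] k0; have /andP[Yw0 _] := YM w.
rewrite Young_max0_ge0//=; apply: (Young_le_max0 HPhi).
by rewrite lerN2 lerD2r divr_ge0// ltW.
Qed.

Lemma up_part_integrable Phi Y M k : continuous_strict_Young Phi ->
  bounded_nonneg Y M -> 0 < k ->
  P.-integrable setT (EFin \o (fun w => up_part Phi (Y w / k))).
Proof.
move=> HPhi HY k0; apply: (bounded_integrable P); last first.
  by move=> w; exact: (up_part_bounded w HPhi HY k0).
case: HY => mY _; exact: (mean_comp_measurable (up_part_continuous HPhi) mY).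
Qed.

Lemma down_part_integrable Phi Y M k : continuous_strict_Young Phi ->
  bounded_nonneg Y M -> 0 < k ->
  P.-integrable setT (EFin \o (fun w => down_part Phi (Y w / k))).
Proof.
move=> HPhi HY k0; apply: (bounded_integrable P); last first.
  by move=> w; exact: (down_part_bounded w HPhi HY k0).
case: HY => mY _; exact: (mean_comp_measurable (down_part_continuous HPhi) mY).
Qed.

Lemma div_measurable f k : continuous f ->
  measurable_fun setT (fun x : R => f (x / k)).
Proof.
move=> fc; apply: (measurableT_comp (continuous_measurable_fun fc)).
exact: measurable_funM.
Qed.

Lemma excess_mean Phi X Y M k : continuous_strict_Young Phi ->
  bounded_nonneg Y M -> measurable_fun setT X -> {ae P, forall w, X w = Y w} ->
  0 < k -> excess P Phi X k = (mean P (up_part Phi) Y k)%:E.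
Proof.
move=> HPhi HY mX XY k0; have [mY _] := HY.
transitivity ('E_P[fun w => up_part Phi (X w / k)%R])%E.
  congr ('E_P[_])%E; apply/funext => w; rewrite /up_part.
  by rewrite -(divff (lt0r_neq0 k0)) -mulrBl maxr_pMl ?invr_ge0 ?ltW// mul0r.
have mPhi := div_measurable k (up_part_continuous HPhi).
rewrite (eq_ae_expectation mPhi mX mY XY).
rewrite unlock /mean /Rintegral fineK//; apply: integrable_fin_num => //.
exact: (up_part_integrable HPhi HY k0).
Qed.

Lemma shortfall_mean Phi X Y M k : continuous_strict_Young Phi ->
  bounded_nonneg Y M -> measurable_fun setT X -> {ae P, forall w, X w = Y w} ->
  0 < k -> shortfall P Phi X k = (mean P (down_part Phi) Y k)%:E.
Proof.
move=> HPhi HY mX XY k0; have [mY _] := HY.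
transitivity ('E_P[fun w => down_part Phi (X w / k)%R])%E.
  congr ('E_P[_])%E; apply/funext => w; rewrite /down_part opprB.
  by rewrite -(divff (lt0r_neq0 k0)) -mulrBl maxr_pMl ?invr_ge0 ?ltW// mul0r.
have mPhi := div_measurable k (down_part_continuous HPhi).
rewrite (eq_ae_expectation mPhi mX mY XY).
rewrite unlock /mean /Rintegral fineK//; apply: integrable_fin_num => //.
exact: (down_part_integrable HPhi HY k0).
Qed.

Lemma asym_Phi_premium_function alpha Phi1 Phi2 : 0 < alpha < 1 ->
  continuous_strict_Young Phi1 -> continuous_strict_Young Phi2 ->
  premium_function (asym_Phi alpha Phi1 Phi2).
Proof.
move=> a01 HPhi1 HPhi2; split.
- exact: asym_Phi_continuous.
- exact: asym_Phi_lt.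
- exact: asym_Phi0_lt1.
- exact: asym_Phi1.
Qed.

(** By linearity; hence the mean equals 1 exactly when the two weighted terms agree, which is the
    equation of (a). *)
Lemma mean_asym_Phi alpha Phi1 Phi2 Y M k :
  continuous_strict_Young Phi1 -> continuous_strict_Young Phi2 ->
  bounded_nonneg Y M -> 0 < k ->
  mean P (asym_Phi alpha Phi1 Phi2) Y k =
  1 + alpha * mean P (up_part Phi1) Y k
    - (1 - alpha) * mean P (down_part Phi2) Y k.
Proof.
move=> HPhi1 HPhi2 HY k0.
have int1 := up_part_integrable HPhi1 HY k0.
have int2 := down_part_integrable HPhi2 HY k0.
have Zint (c : R) (g : T -> R) : P.-integrable setT (EFin \o g) ->
    P.-integrable setT (EFin \o (fun w => c * g w)).
  by move=> /(integrableZl measurableT c).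
have intc : P.-integrable setT (EFin \o (cst 1 : T -> R)).
  by apply: (@bounded_integrable _ _ _ P _ 1 1) => // w; rewrite lexx.
rewrite -(RintegralZl _ measurableT int1) -(RintegralZl _ measurableT int2).
have int1E : \int[P]_w (1 : R) = 1.
  by rewrite Rintegral_cst//= (probability_setT P) mulr1.
rewrite -[X in _ = X + _ - _]int1E.
rewrite -RintegralD//; last exact: Zint.
rewrite -RintegralB//; last exact: Zint.
by have := integrableD measurableT intc (Zint alpha _ int1).
Qed.

Lemma asym_premium_ae alpha Phi1 Phi2 X Y : 0 < alpha < 1 ->
  continuous_strict_Young Phi1 -> continuous_strict_Young Phi2 ->
  measurable_fun setT X -> measurable_fun setT Y ->
  {ae P, forall w, X w = Y w} ->
  asym_premium P alpha Phi1 Phi2 X =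
  orlicz_premium P (asym_Phi alpha Phi1 Phi2) Y.
Proof.
move=> a01 HPhi1 HPhi2 mX mY XY.
have Gc := asym_Phi_continuous (alpha := alpha) HPhi1 HPhi2.
by congr inf; apply/seteqP; split => k [k0 Gk]; split => //;
  move: Gk; rewrite (eq_ae_expectation (div_measurable k Gc) mX mY XY).
Qed.

(** A strictly increasing Young function vanishes only at 0, so zero excess gives Y <= k a.s. and
    zero shortfall gives Y >= k a.s. *)
Lemma means_eq0_ae Phi1 Phi2 Y M k :
  continuous_strict_Young Phi1 -> continuous_strict_Young Phi2 ->
  bounded_nonneg Y M -> 0 < k ->
  mean P (up_part Phi1) Y k = 0 -> mean P (down_part Phi2) Y k = 0 ->
  {ae P, forall w, Y w = k}.
Proof.
move=> HPhi1 HPhi2 HY k0 up0 down0.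
have up0_ae := Rintegral_eq0_ae (up_part_integrable HPhi1 HY k0) _ up0.
have down0_ae := Rintegral_eq0_ae (down_part_integrable HPhi2 HY k0) _ down0.
have [] := (up0_ae _, down0_ae _).
- by move=> w; exact: Young_max0_ge0.
- by move=> w; exact: Young_max0_ge0.
apply: filterS2 => w /(Young_max0_eq0 HPhi1) + /(Young_max0_eq0 HPhi2).
rewrite oppr_le0 subr_le0 subr_ge0 ler_pdivrMr// ler_pdivlMr// mul1r => Yk kY.
by apply/eqP; rewrite eq_le Yk.
Qed.

End asym_premium.

Theorem proposition16 (d : measure_display) (T : measurableType d)
    (R : realType) (P : probability T R) (HP : nonatomic P)
    (Phi1 Phi2 : R -> R)
    (HPhi1 : continuous_strict_Young Phi1)
    (HPhi2 : continuous_strict_Young Phi2) :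
  (forall (alpha : R) (X : T -> R),
     0 < alpha < 1 -> Linfty_plus P X -> 0 < asym_premium P alpha Phi1 Phi2 X ->
     (* (a) *)
     unique
       (fun k : R => 0 < k /\
          (alpha%:E * excess P Phi1 X k =
           (1 - alpha)%:E * shortfall P Phi2 X k)%E)
       (asym_premium P alpha Phi1 Phi2 X) /\
     (* (b)(i) *)
     (forall tPhi1 : R -> R, continuous_strict_Young tPhi1 ->
        (forall x : R, 0 <= x -> Phi1 x <= tPhi1 x) ->
        asym_premium P alpha Phi1 Phi2 X <= asym_premium P alpha tPhi1 Phi2 X) /\
     (* (b)(ii) *)
     (forall tPhi2 : R -> R, continuous_strict_Young tPhi2 ->
        (forall x : R, 0 <= x -> Phi2 x <= tPhi2 x) ->
        asym_premium P alpha Phi1 Phi2 X >= asym_premium P alpha Phi1 tPhi2 X) /\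
     (* (b)(iii) *)
     {in `]0, 1[ &,
       {homo (fun a : R => asym_premium P a Phi1 Phi2 X) : a b / a <= b}} /\
     (forall a0 : R, 0 < a0 < 1 ->
        (0 < P [set w | X w <> asym_premium P a0 Phi1 Phi2 X])%E ->
        {in `]0, 1[ &,
          {homo (fun a : R => asym_premium P a Phi1 Phi2 X) : a b / a < b}})) /\
  (* (c) *)
  (forall X Y : T -> R, Linfty_plus P X -> Linfty_plus P Y ->
     Young_order P Phi1 Phi2 X Y ->
     forall alpha : R, 0 < alpha < 1 ->
       asym_premium P alpha Phi1 Phi2 X <= asym_premium P alpha Phi1 Phi2 Y).
Proof.
split; last first.

  (* Part (c): the order compares the means at every k *)
  move=> X Y HX HY XY alpha a01.
  have [X' [M [HX' mX XX']]] := Linfty_plus_bounded HX.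
  have [Y' [N [HY' mY YY']]] := Linfty_plus_bounded HY.
  have [mX' _] := HX'; have [mY' _] := HY'.
  rewrite (asym_premium_ae a01 HPhi1 HPhi2 mX mX' XX').
  rewrite (asym_premium_ae a01 HPhi1 HPhi2 mY mY' YY').
  have HG := asym_Phi_premium_function a01 HPhi1 HPhi2.
  apply: (le_orlicz_premium HG HX' HG HY') => k k0.
  rewrite (mean_asym_Phi P alpha HPhi1 HPhi2 HX' k0).
  rewrite (mean_asym_Phi P alpha HPhi1 HPhi2 HY' k0).
  have [] := XY k k0.
  rewrite (excess_mean HPhi1 HX' mX XX' k0) (excess_mean HPhi1 HY' mY YY' k0).
  rewrite (shortfall_mean HPhi2 HX' mX XX' k0).
  rewrite (shortfall_mean HPhi2 HY' mY YY' k0).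
  rewrite !lee_fin => up_le down_ge; have /andP[a0 a1] := a01.
  by apply: lerB; rewrite ?lerD2l ler_pM2l// subr_gt0.

(* Setup for (a) and (b): the premium h(a) of a bounded representative as the root for parameter
   a *)
move=> alpha X a01 HX.
have [Y [M [HY mX XY]]] := Linfty_plus_bounded HX; have [mY YM] := HY.
have premiumE a Psi1 Psi2 (a01 : 0 < a < 1) HPsi1 HPsi2 :=
  @asym_premium_ae _ _ _ P a Psi1 Psi2 X Y a01 HPsi1 HPsi2 mX mY XY.
rewrite (premiumE _ _ _ a01 HPhi1 HPhi2) => h0.
pose h a := orlicz_premium P (asym_Phi a Phi1 Phi2) Y.
have HG a (a01 : 0 < a < 1) := asym_Phi_premium_function a01 HPhi1 HPhi2.
pose u k := mean P (up_part Phi1) Y k.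
pose v k := mean P (down_part Phi2) Y k.
have meanE a k : 0 < k ->
    mean P (asym_Phi a Phi1 Phi2) Y k = 1 + a * u k - (1 - a) * v k.
  exact: mean_asym_Phi.
(* Positivity is assumed at [alpha] only; it yields E[Y] > 0, and the affine minorant then gives it
   for every a. *)
have h_gt0 a : 0 < a < 1 -> 0 < h a.
  move=> a01'; have /andP[a0 _] := a01'.
  apply: (orlicz_premium_gt0 (HG _ a01') HY a0).
    by move=> x; exact: asym_Phi_ge_affine.
  exact: (orlicz_premium_gt0_Rintegral (HG _ a01) HY h0).
have h_eq a : 0 < a < 1 -> a * u (h a) = (1 - a) * v (h a).
  move=> a01'; have := mean_orlicz_premium (HG _ a01') HY (h_gt0 _ a01').
  rewrite meanE ?h_gt0// => /eqP; rewrite -addrA -subr_eq0 addrAC subrr add0r.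
  by rewrite subr_eq0 => /eqP.
have h_unique a k : 0 < a < 1 -> 0 < k -> a * u k = (1 - a) * v k -> h a = k.
  move=> a01' k0 uv.
  apply: (orlicz_premium_unique (HG _ a01') HY (h_gt0 _ a01') k0).
  by rewrite meanE// uv addrK.
(* A larger parameter puts more weight on the nonnegative excess u and less on the nonnegative
   shortfall v, so the mean grows at each k. *)
have h_le a b : 0 < a < 1 -> 0 < b < 1 -> a <= b -> h a <= h b.
  move=> a01' b01 ab; apply: (le_orlicz_premium (HG _ a01') HY (HG _ b01) HY).
  move=> k k0; rewrite !meanE//.
  have uk0 : 0 <= u k by apply: Rintegral_ge0 => w _; exact: Young_max0_ge0.
  have vk0 : 0 <= v k by apply: Rintegral_ge0 => w _; exact: Young_max0_ge0.
  by rewrite lerB ?lerD2l ?ler_wpM2r// lerD2l lerN2.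
split; [|split; [|split; [|split]]].

(* Part (a): the premium solves the equation, and every solution equals it *)
- split.
    split=> //; rewrite (excess_mean HPhi1 HY mX XY h0).
    by rewrite (shortfall_mean HPhi2 HY mX XY h0) -!EFinM h_eq.
  move=> k [k0]; rewrite (excess_mean HPhi1 HY mX XY k0).
  by rewrite (shortfall_mean HPhi2 HY mX XY k0) => -[]; exact: h_unique.

(* Parts (b)(i) and (b)(ii): pointwise comparison of the integrands *)
- move=> Psi HPsi PhiPsi; rewrite (premiumE _ _ _ a01 HPsi HPhi2).
  have HGPsi := asym_Phi_premium_function a01 HPsi HPhi2.
  apply: (le_orlicz_premium (HG _ a01) HY HGPsi HY) => k k0.
  have [Gc Glt _ _] := HG _ a01; have [Hc Hlt _ _] := HGPsi.
  apply: le_Rintegral => //.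
  + exact: (mean_integrable P Gc Glt mY YM k0).
  + exact: (mean_integrable P Hc Hlt mY YM k0).
  have /andP[a0 _] := a01.
  move=> w _; rewrite /asym_Phi lerD2r lerD2l ler_pM2l// PhiPsi//.
  by rewrite le_max lexx orbT.
- move=> Psi HPsi PhiPsi; rewrite (premiumE _ _ _ a01 HPhi1 HPsi).
  have HGPsi := asym_Phi_premium_function a01 HPhi1 HPsi.
  apply: (le_orlicz_premium HGPsi HY (HG _ a01) HY) => k k0.
  have [Gc Glt _ _] := HG _ a01; have [Hc Hlt _ _] := HGPsi.
  apply: le_Rintegral => //.
  + exact: (mean_integrable P Hc Hlt mY YM k0).
  + exact: (mean_integrable P Gc Glt mY YM k0).
  have /andP[_ a1] := a01.
  move=> w _; rewrite /asym_Phi lerD2l lerN2 ler_pM2l ?subr_gt0// PhiPsi//.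
  by rewrite le_max lexx orbT.

(* Part (b)(iii): monotonicity in the parameter, then strictness *)
- move=> a b /=; rewrite !in_itv/= => a01' b01 ab.
  by rewrite !premiumE//; exact: h_le.
move=> a0 a001 Xa0 a b; rewrite !in_itv/= => a01' b01 ab.
rewrite !premiumE// lt_neqAle h_le ?(ltW ab)// andbT; apply/eqP => hab.
have ha0 := h_gt0 _ a01'.
have := h_eq _ b01; rewrite -[h b]hab => eb; have ea := h_eq _ a01'.
have u0 : 0 <= u (h a) by apply: Rintegral_ge0 => w _; exact: Young_max0_ge0.
have v0 : 0 <= v (h a) by apply: Rintegral_ge0 => w _; exact: Young_max0_ge0.
(* Difference of the two root equations, for a and for b, at the common root. *)
have /eqP : (b - a) * (u (h a) + v (h a)) = 0.
  by move: ea eb; rewrite !mulrBl !mulrDr !mul1r; lra.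
rewrite mulf_eq0 subr_eq0 (gt_eqF ab)/= paddr_eq0// => /andP[/eqP ua0 /eqP va0].
have Yh := means_eq0_ae HPhi1 HPhi2 HY ha0 ua0 va0.
(* With u = v = 0 at [h a] the root equation holds there for every parameter, in particular for
   [a0], the one in the hypothesis on X. *)
have ha0E : h a0 = h a by apply: h_unique => //; rewrite ua0 va0 !mulr0.
have [N [mN PN hN]] : {ae P, forall w, X w = h a0}.
  by apply: filterS2 XY Yh => w -> ->.
move: Xa0; rewrite premiumE// (_ : P _ = 0%E) ?ltxx//.
apply: (subset_measure0 _ mN _ PN) => //.
rewrite [X in measurable X](_ : _ = X @^-1` (~` [set h a0])) //.
rewrite -[X in measurable X]setTI; apply: mX => //.
exact: measurableC.
Qed.
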